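(* Let $G$ be a finite abelian group and let $A$, $B$, $S$ be non-empty subsets of $G$. Then $$|A\oplus_S B|\geq \min\{|A|+|B|-3|S|,\ p(G)\}.$$
   Context: For subsets $A,B,S$ of an abelian group $G$ (written additively), the generalized restricted sumset is $A\oplus_S B:=\{a+b:\ a\in A,\ b\in B,\ a-b\notin S\}$. For a finite group $G$ with $|G|>1$, $p(G)$ denotes the least prime factor of $|G|$. *)

(* Defs.v *)
From HB Require Import structures.
From mathcomp Require Import all_boot all_order all_algebra.
Set Implicit Arguments. Unset Strict Implicit. Unset Printing Implicit Defensive.
Import GRing.Theory Num.Theory.
Local Open Scope ring_scope.

Definition restr_sumset (G : finZmodType) (A B S : {set G}) : {set G} :=
  [set a + b | a in A, b in [set b in B | (a - b) \notin S]].

Definition pG (G : finZmodType) : nat := pdiv #|[set: G]|.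

(* Main.v *)
Require Import Defs.
From HB Require Import structures.
From mathcomp Require Import all_boot all_order all_algebra.
From mathcomp Require Import all_fingroup all_solvable.
From mathcomp Require Import ring zify.
Import Order.TTheory GRing.Theory Num.Theory.
Set Implicit Arguments. Unset Strict Implicit. Unset Printing Implicit Defensive.
Local Open Scope ring_scope.

(** Let p be the least prime factor of |G| and assume that the restricted
    sumset C has fewer than p elements; the claim is |A| + |B| <= |C| + 3|S|.
    For p = 2 this is immediate.

    In F_q with q odd and 0 < |S| < q the polynomial method gives the stronger
    bound |A| + |B| <= |C| + |S| + 2: the polynomial
    prod_(c in C) (x + y - c) * prod_(s in S) (x - y - s) vanishes on A x B,
    while the coefficients of its top form are those of
    (1 + X)^|C| (1 - X)^|S|, two consecutive ones of which never vanish both.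

    In general, take a subgroup K of prime index q in the subgroup H containing
    (up to translation) A and B, and cut A, B, S, C into fibres over F_q.  By
    induction on H, fibres of A and B over i and j, of sizes f i and g j, give
    f i + g j <= c (i + j) + 3 s (i - j), or f i + g j <= c (i + j) + 1 if
    s (i - j) = 0 (Cauchy-Davenport).  If the support of f is not larger than
    that of g and f is maximal at i, summing over the pairs (i, j) nearly gives
    the bound; what is missing is supplied by the classes outside i + supp g,
    which are counted by the bound in F_q. *)

(** * Coefficients of (1 + X)^k (1 - X)^m *)

(* The polynomial (1 + X)^k (1 - X)^m is a zero of [ode k m]; were two of its
   consecutive coefficients 0, its truncation before them would be a zero too,
   but the nonzero zeros of [ode k m] have degree at least k + m. *)
Definition ode (F : fieldType) (k m : nat) (Q : {poly F}) : {poly F} :=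
  (1 - 'X) * (1 + 'X) * Q^`() - (k%:R * (1 - 'X) - m%:R * (1 + 'X)) * Q.

Lemma odeD (F : fieldType) k m (P Q : {poly F}) :
  ode k m (P + Q) = ode k m P + ode k m Q.
Proof. by rewrite /ode derivD; ring. Qed.

(** Up to clearing denominators, [ode k m Q] is Q times the difference of the logarithmic
    derivatives of Q and (1 + X)^k (1 - X)^m, so a factor 1 + X in Q is offset by raising k. *)
Lemma ode_mul_plus (F : fieldType) k m (Q : {poly F}) :
  ode k.+1 m ((1 + 'X) * Q) = (1 + 'X) * ode k m Q.
Proof.
rewrite /ode derivM derivD derivX -[1]/(1%:P) derivC -[1%:P]/(1 : {poly F}).
by rewrite -natr1; ring.
Qed.

Lemma ode_mul_minus (F : fieldType) k m (Q : {poly F}) :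
  ode k m.+1 ((1 - 'X) * Q) = (1 - 'X) * ode k m Q.
Proof.
rewrite /ode derivM derivB derivX -[1]/(1%:P) derivC -[1%:P]/(1 : {poly F}).
by rewrite -natr1; ring.
Qed.

Lemma ode_prod (F : fieldType) k m :
  ode k m ((1 + 'X) ^+ k * (1 - 'X) ^+ m : {poly F}) = 0.
Proof.
elim: k => [|k IHk]; last by rewrite exprS -mulrA ode_mul_plus IHk mulr0.
elim: m => [|m IHm]; last first.
  by rewrite exprS mulrCA ode_mul_minus IHm mulr0.
by rewrite !expr0 mulr1 /ode -[1]/(1%:P) derivC; ring.
Qed.

(** Evaluating the equation at -1 if k > 0, or at 1 if m > 0, kills the derivative term and forces a
    root of Q there; dividing by the linear factor lowers k or m by one. *)
Lemma ode_size (F : fieldType) k m (Q : {poly F}) :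
  2%:R != 0 :> F ->
  (forall n, (0 < n <= k)%N -> n%:R != 0 :> F) ->
  (forall n, (0 < n <= m)%N -> n%:R != 0 :> F) ->
  Q != 0 -> ode k m Q = 0 -> (k + m < size Q)%N.
Proof.
move=> two0; elim: k Q => [|k IHk] Q.
  elim: m Q => [|m IHm] Q _ hm Q0 odeQ; first by rewrite add0n size_poly_gt0.
  have Q1 : Q.[1] = 0.
    move: (congr1 (horner^~ 1) odeQ).
    rewrite /ode !(hornerE, horner_exp) => h.
    have /eqP : m.+1%:R.[1] * (1 + 1) * Q.[1] = 0 by rewrite -[RHS]h; ring.
    rewrite mulf_eq0 => /orP [|/eqP //].
    rewrite -polyC_natr hornerC -[1 + 1]/(2%:R) mulf_eq0 (negPf two0) orbF.
    by rewrite (negPf (hm _ _)) ?leqnn.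
  have /factor_theorem [R defR] : root Q 1 by apply/rootP.
  have defQ : Q = (1 - 'X) * - R by rewrite defR polyC1; ring.
  have R0 : - R != 0 by apply: contraNneq Q0 => R0; rewrite defQ R0 mulr0.
  have X1 : (1 - 'X : {poly F}) != 0.
    by rewrite -opprB oppr_eq0 polyXsubC_eq0.
  have sz : size Q = (size (- R)).+1.
    by rewrite defQ size_mul // -[1 - 'X]opprB !size_polyN -polyC1 size_XsubC.
  rewrite sz addnS ltnS; apply: IHm => // [n|n /andP [n0 nm]|].
    by case: n.
    by apply: hm; rewrite n0 leqW.
  move: odeQ; rewrite defQ ode_mul_minus => /eqP.
  by rewrite mulf_eq0 (negPf X1) => /eqP.
move=> hk hm Q0 odeQ.
have Q1 : Q.[-1] = 0.
  move: (congr1 (horner^~ (-1)) odeQ).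
  rewrite /ode !(hornerE, horner_exp) => h.
  have /eqP : k.+1%:R.[-1] * (1 + 1) * Q.[-1] = 0.
    by rewrite -[RHS]oppr0 -[in RHS]h; ring.
  rewrite mulf_eq0 => /orP [|/eqP //].
  rewrite -polyC_natr hornerC -[1 + 1]/(2%:R) mulf_eq0 (negPf two0) orbF.
  by rewrite (negPf (hk _ _)) ?leqnn.
have /factor_theorem [R defR] : root Q (-1) by apply/rootP.
have defQ : Q = (1 + 'X) * R by rewrite defR polyCN polyC1; ring.
have R0 : R != 0 by apply: contraNneq Q0 => R0; rewrite defQ R0 mulr0.
have X1 : (1 + 'X : {poly F}) != 0.
  by rewrite addrC -[1]/(1%:P) -size_poly_gt0 size_XaddC.
have sz : size Q = (size R).+1.
  by rewrite defQ size_mul // addrC -[1]/(1%:P) size_XaddC.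
rewrite sz addSn ltnS; apply: IHk => // [n /andP [n0 nm]|].
  by apply: hk; rewrite n0 leqW.
move: odeQ; rewrite defQ ode_mul_plus => /eqP.
by rewrite mulf_eq0 (negPf X1) => /eqP.
Qed.

Lemma no_consecutive_zeros (F : fieldType) k m j :
  2%:R != 0 :> F ->
  (forall n, (0 < n <= k)%N -> n%:R != 0 :> F) ->
  (forall n, (0 < n <= m)%N -> n%:R != 0 :> F) ->
  (j < k + m)%N ->
  (((1 + 'X) ^+ k * (1 - 'X) ^+ m : {poly F})`_j != 0) ||
  (((1 + 'X) ^+ k * (1 - 'X) ^+ m : {poly F})`_j.+1 != 0).
Proof.
move=> two0 hk hm ltj; set P := _ * _.
rewrite -negb_and; apply/negP => /andP [/eqP Pj /eqP Pj1].
have P0 : P`_0 = 1.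
  by rewrite -horner_coef0 /P !(hornerE, horner_exp) ?(addr0, subr0, oppr0) !expr1n ?mulr1.
case: j ltj Pj Pj1 => [_ Pj _|j ltj Pj Pj1].
  by move/eqP: Pj; rewrite P0 oner_eq0.
(* After the case split the vanishing coefficients are those of index j + 1 and j + 2. *)
pose L := take_poly j.+1 P; pose U := drop_poly j.+3 P.
have defP : P = L + 'X^(j.+3) * U.
  apply/polyP => i; rewrite coefD coef_take_poly coefXnM coef_drop_poly.
  case: ltngtP => [lti|gti|->]; last by rewrite Pj /= ltnW ?addr0 // ltnW.
    by rewrite ltnW ?addr0 // ltnW.
  rewrite add0r; case: ltnP => [lti|gei]; last by rewrite subnK.
  by have -> : i = j.+2 by lia.
have L0 : L != 0.
  apply/eqP => /(congr1 (fun p : {poly F} => p`_0)).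
  by rewrite coef_take_poly coef0 P0 => /eqP; rewrite oner_eq0.
have szL : (size L <= j.+1)%N by apply: size_take_poly.
pose V := (1 - 'X) * (1 + 'X) * (j.+3%:R * U + 'X * U^`())
   - (k%:R * (1 - 'X) - m%:R * (1 + 'X)) * 'X * U.
have odeU : ode k m ('X^(j.+3) * U) = 'X^(j.+2) * V.
  rewrite /ode /V derivM derivXn /= -mulr_natr [in LHS](exprS _ j.+2).
  have ringE (y n a b u u' : {poly F}) :
      (1 - 'X) * (1 + 'X) * (y * n * u + 'X * y * u')
        - (a * (1 - 'X) - b * (1 + 'X)) * ('X * y * u)
      = y * ((1 - 'X) * (1 + 'X) * (n * u + 'X * u')
             - (a * (1 - 'X) - b * (1 + 'X)) * 'X * u).
    by ring.
  exact: ringE.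
have odeL : ode k m L = - ('X^(j.+2) * V).
  by have := ode_prod F k m; rewrite -/P {1}defP odeD odeU => /eqP; rewrite addr_eq0 => /eqP.
(* [ode] raises the degree by at most one, so [ode k m L] has degree at most j + 1; being a multiple
   of X^(j+2), it is 0. *)
have odeL0 : ode k m L = 0.
  apply/polyP => i; rewrite coef0; case: (ltnP i j.+2) => hi.
    by rewrite odeL coefN coefXnM hi oppr0.
  have sz1 : (size (ode k m L) <= j.+2)%N.
    have sX (a : F) (b : F) : (size (a%:P + b%:P * 'X)%R <= 2)%N.
      rewrite addrC mul_polyC; apply: (leq_trans (size_polyD _ _)); rewrite geq_max.
      rewrite (leq_trans (size_scale_leq _ _)) ?size_polyX //.
      by rewrite (leq_trans (size_polyC_leq1 _)).
    have e1 : (1 - 'X) * (1 + 'X) = 1 - 'X^2 :> {poly F} by ring.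
    have e2 : k%:R * (1 - 'X) - m%:R * (1 + 'X) =
        (k%:R - m%:R)%:P + (- (k%:R + m%:R))%:P * 'X :> {poly F}.
      by rewrite polyCN polyCB polyCD !polyC_natr; ring.
    rewrite /ode e1 e2; apply: (leq_trans (size_polyD _ _)); rewrite geq_max size_polyN.
    have sM (p q : {poly F}) u v : (size p <= u)%N -> (size q <= v)%N ->
        (u + v <= j.+3)%N -> (size (p * q)%R <= j.+2)%N.
      by move=> hu hv huv; have := size_polyMleq p q; lia.
    apply/andP; split.
      apply: (sM _ _ 3 j); last by lia.
        apply: (leq_trans (size_polyD _ _)).
        by rewrite geq_max size_polyN size_polyXn size_poly1.
      by rewrite -ltnS; apply: leq_trans (lt_size_deriv L0) szL.
    by apply: (sM _ _ 2 j.+1) => //; lia.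
  by rewrite nth_default // (leq_trans sz1).
by have := leq_trans (ode_size two0 hk hm L0 odeL0) szL; lia.
Qed.

(** * Coefficient extraction by evaluation at points *)

(* The functional is the divided difference at the points of [s]. *)
Lemma coef_functional (F : fieldType) (s : seq F) : uniq s -> (0 < size s)%N ->
  exists w : F -> F, forall p : {poly F}, (size p <= size s)%N ->
    \sum_(x <- s) w x * p.[x] = p`_(size s).-1.
Proof.
elim: s => // x0 s IHs /= /andP [x0s us] _.
have [->|s0] := eqVneq s [::].
  exists (fun=> 1) => p /= sp; rewrite big_seq1 mul1r.
  by rewrite [p in p.[_]]size1_polyC // hornerC.
have szs : (0 < size s)%N by case: (s) s0.
have [w hw] := IHs us szs.
pose v x := w x / (x - x0).
(* The weight at [x0] makes the functional kill constants, so [p] may be replaced by p - p(x0) = q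
   (X - x0), and [v] cancels the factor x - x0. *)
exists (fun x => if x == x0 then - \sum_(x <- s) v x else v x) => p sp.
have /factor_theorem [q defq] : root (p - p.[x0]%:P) x0.
  by rewrite /root !hornerE subrr.
have defp : p = q * ('X - x0%:P) + p.[x0]%:P by rewrite -defq subrK.
have sq : (size q <= size s)%N.
  have [->|q0] := eqVneq q 0; first by rewrite size_poly0.
  have : (size (p - p.[x0]%:P)%R <= (size s).+1)%N.
    apply: (leq_trans (size_polyD _ _)); rewrite geq_max sp size_polyN.
    by apply: (leq_trans (size_polyC_leq1 _)).
  by rewrite defq size_Mmonic ?monicXsubC // size_XsubC addn2.
have -> : p`_(size s) = q`_(size s).-1.
  rewrite defp coefD coefC mulrBr coefB coefMX coefMC.
  case: (size s) szs sq => //= n _ sq.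
  by rewrite addr0 (nth_default _ sq) mul0r subr0.
rewrite -(hw _ sq).
rewrite big_cons eqxx mulNr mulr_suml addrC big_seq_cond.
rewrite (eq_bigr (fun x => v x * p.[x])); last first.
  by move=> x /andP [xs _]; case: eqVneq xs x0s => // -> ->.
rewrite -big_seq_cond -sumrB big_seq [RHS]big_seq; apply: eq_bigr => x xs.
have nx : x != x0 by apply: contraNneq x0s => <-.
rewrite -mulrBr.
have -> : p.[x] - p.[x0] = q.[x] * (x - x0) by rewrite {1}defp !hornerE addrK.
by rewrite /v mulrA mulrAC divfK // subr_eq0.
Qed.

Section CoefficientFunctional.
Variables (F : fieldType) (s1 s2 : seq F) (w1 w2 : F -> F) (a b : nat).
Hypothesis hw1 : forall i, (i <= a)%N -> \sum_(x <- s1) w1 x * x ^+ i = (i == a)%:R.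
Hypothesis hw2 : forall i, (i <= b)%N -> \sum_(x <- s2) w2 x * x ^+ i = (i == b)%:R.

(** The double functional extracts the coefficient of x^a y^b. In total degree at most a + b only
    the top form matters, and x = 1, y = X makes it univariate. The induction expands one linear
    factor at a time; its constant term lowers the degree and contributes 0. *)
Lemma functional_prod_linear (ls : seq (F * F * F)) i j :
  (size ls + i + j <= a + b)%N ->
  \sum_(x <- s1) \sum_(y <- s2) w1 x * w2 y *
     (x ^+ i * y ^+ j * \prod_(l <- ls) (l.1.1 * x + l.1.2 * y + l.2)) =
  if (size ls + i + j == a + b)%N then
    ('X^j * \prod_(l <- ls) (l.1.1%:P + l.1.2%:P * 'X) : {poly F})`_b else 0.
Proof.
elim: ls i j => [|l ls IH] i j /=.
  rewrite add0n => leij; rewrite big_nil mulr1 coefXn.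
  transitivity ((\sum_(x <- s1) w1 x * x ^+ i) * (\sum_(y <- s2) w2 y * y ^+ j)).
    rewrite mulr_suml; apply: eq_bigr => x _; rewrite mulr_sumr.
    by apply: eq_bigr => y _; rewrite big_nil; ring.
  case: (ltngtP i a) => [lti|gti|eqi].
  - rewrite hw1 1?ltnW // (ltn_eqF lti) mul0r; case: eqP => // e.
    by case: eqP => // e'; lia.
  - rewrite [X in _ * X]hw2; last by lia.
    have -> : (j == b) = false by lia.
    rewrite mulr0; case: ifP => // _.
    by have -> : (b == j) = false by lia.
  rewrite hw1 ?eqi // eqxx mul1r hw2; last by lia.
  by rewrite eqn_add2l eq_sym; case: eqP.
move=> le.
transitivity (l.1.1 * (\sum_(x <- s1) \sum_(y <- s2) w1 x * w2 y *
     (x ^+ i.+1 * y ^+ j * \prod_(l <- ls) (l.1.1 * x + l.1.2 * y + l.2)))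
  + l.1.2 * (\sum_(x <- s1) \sum_(y <- s2) w1 x * w2 y *
     (x ^+ i * y ^+ j.+1 * \prod_(l <- ls) (l.1.1 * x + l.1.2 * y + l.2)))
  + l.2 * (\sum_(x <- s1) \sum_(y <- s2) w1 x * w2 y *
     (x ^+ i * y ^+ j * \prod_(l <- ls) (l.1.1 * x + l.1.2 * y + l.2)))).
  rewrite !mulr_sumr -!big_split; apply: eq_bigr => x _.
  rewrite !mulr_sumr -!big_split; apply: eq_bigr => y _ /=.
  by rewrite big_cons !exprS; ring.
rewrite !IH; try by lia.
have -> : (size ls + i + j == a + b)%N = false by lia.
have -> : (size ls + i.+1 + j == a + b)%N = ((size ls).+1 + i + j == a + b)%N by lia.
have -> : (size ls + i + j.+1 == a + b)%N = ((size ls).+1 + i + j == a + b)%N by lia.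
rewrite mulr0 addr0; case: ifP => // _; last by rewrite !mulr0 addr0.
rewrite big_cons -!coefCM -coefD; congr (polyseq _)`_b.
by rewrite exprS; ring.
Qed.

End CoefficientFunctional.

(** * Cauchy-Davenport theorem below the least prime factor *)

(** A contains a coset of the subgroup generated by d, whose order is a divisor of |G| greater than
    1. *)
Lemma le_pdiv_stable (G : finZmodType) (A : {set G}) (d : G) :
  A != set0 -> d != 0 -> (forall a, a \in A -> a + d \in A) ->
  (pdiv #|[set: G]| <= #|A|)%N.
Proof.
case/set0Pn => a aA d0 stab.
have sub : [set a + x | x in <[d]>%g] \subset A.
  apply/subsetP => _ /imsetP [x /cycleP [n ->] ->]; rewrite FinRing.zmodXgE.
  by elim: n => [|n IHn]; rewrite ?mulr0n ?addr0 // mulrSr addrA stab.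
have := subset_leq_card sub; rewrite card_imset; last exact: addrI.
apply: leq_trans; apply: pdiv_min_dvd; last by apply: cardSg; apply: subsetT.
by rewrite -/(order d) order_gt1.
Qed.

Definition sumset (G : finZmodType) (A B : {set G}) : {set G} :=
  [set a + b | a in A, b in B].

Lemma Cauchy_Davenport (G : finZmodType) (A B : {set G}) :
  A != set0 -> B != set0 -> (#|sumset A B| < pdiv #|[set: G]|)%N ->
  (#|A| + #|B| <= #|sumset A B| + 1)%N.
Proof.
have [n] := ubnP #|B|; elim: n A B => // n IHn A B /ltnSE leBn A0 B0 ltp.
have /set0Pn [b bB] := B0.
have leA : (#|A| <= #|sumset A B|)%N.
  rewrite -(card_imset (mem A) (addIr b)); apply: subset_leq_card.
  by apply/subsetP => _ /imsetP [a aA ->]; apply: imset2_f.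
case: (leqP #|B| 1) => [le1|]; first by lia.
move=> /card_gt1P [x [y [xB yB nxy]]].
(* |A| is below the least prime factor of |G|, so A is not stable under x - y. *)
have [a aA adA] : exists2 a, a \in A & a + (x - y) \notin A.
  apply/exists_inP; rewrite -negb_forall_in; apply/negP => /forall_inP stab.
  have := le_pdiv_stable A0 _ stab; rewrite subr_eq0 nxy => /(_ isT).
  by move=> h; move: ltp; rewrite ltnNge (leq_trans h).
(* Dyson transform: [A :&: (B + e)] is nonempty and smaller than [B]. *)
pose e := a - y; pose B' : {set G} := [set b + e | b in B].
have cB' : #|B'| = #|B| by apply: card_imset; apply: addIr.
have aB' : a \in B' by apply/imsetP; exists y => //; rewrite /e addrC subrK.
have xB' : x + e \in B' by apply: imset_f.
have xA : x + e \notin A by rewrite /e addrCA.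
have ltI : (#|A :&: B'| < #|B|)%N.
  rewrite -cB'; apply: proper_card; apply/properP; split; first exact: subsetIr.
  by exists (x + e) => //; rewrite inE (negPf xA).
have sub : [set z - e | z in sumset (A :|: B') (A :&: B')] \subset sumset A B.
  apply/subsetP => _ /imsetP [_ /imset2P [u v uU /setIP [vA vB'] ->] ->].
  case/setUP: uU => [uA|/imsetP [w wB ->]].
    by case/imsetP: vB' => w wB ->; rewrite addrA addrK imset2_f.
  by rewrite addrAC addrK addrC imset2_f.
have := subset_leq_card sub; rewrite card_imset; last exact: addIr.
move=> le; have := cardsUI A B'.
have := IHn (A :|: B') (A :&: B') (leq_trans ltI leBn) _ _ (leq_ltn_trans le ltp).
rewrite cB'.
have -> : A :|: B' != set0 by apply/set0Pn; exists a; rewrite inE aA.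
have -> : A :&: B' != set0 by apply/set0Pn; exists a; rewrite inE aA.
by move=> /(_ isT isT) h <-; apply: (leq_trans h); rewrite leq_add2r.
Qed.

(** * Polynomial method for restricted sumsets in F_q *)

Lemma restr_sumsetP (G : finZmodType) (A B S : {set G}) c :
  reflect (exists a b, [/\ a \in A, b \in B, a - b \notin S & c = a + b])
    (c \in restr_sumset A B S).
Proof.
apply: (iffP imset2P) => [[a b aA]|[a [b [aA bB nS ->]]]].
  by rewrite inE => /andP [bB nS] ->; exists a, b.
by exists a b => //; rewrite inE bB.
Qed.

Lemma restr_sumset_Fp (q : nat) (A B S : {set 'F_q}) :
  prime q -> (2 < q)%N -> A != set0 -> B != set0 -> (0 < #|S| < q)%N ->
  (#|restr_sumset A B S| < q)%N ->
  (#|A| + #|B| <= #|restr_sumset A B S| + #|S| + 2)%N.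
Proof.
move=> pq q2; rewrite -!card_gt0 => A0 B0 /andP [S0 Sq] Cq.
set C := restr_sumset A B S; rewrite -/C in Cq.
have natF n : (0 < n < q)%N -> n%:R != 0 :> 'F_q.
  move=> /andP [n0 nq]; rewrite -(dvdn_pcharf (pchar_Fp pq)).
  by apply/negP => /(dvdn_leq n0); rewrite leqNgt nq.
rewrite leqNgt; apply/negP => ltC.
pose P : {poly 'F_q} := (1 + 'X) ^+ #|C| * (1 - 'X) ^+ #|S|.
(* If |A| or |B| exceeds |C| + |S|, an extreme coefficient of [P] serves, the constant or the
   leading one. Otherwise the admissible b include the consecutive values j and j + 1, where j
   corresponds to a = |A| - 1. *)
have [a [b [ltA ltB defab Pb]]] : exists a b,
    [/\ (a < #|A|)%N, (b < #|B|)%N, (a + b = #|C| + #|S|)%N & P`_b != 0].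
  have [ltA|leA] := ltnP (#|C| + #|S|) #|A|.
    exists (#|C| + #|S|)%N, 0%N; rewrite addn0; split => //.
    rewrite -horner_coef0 /P !(hornerE, horner_exp) ?(addr0, subr0, oppr0).
    by rewrite !expr1n ?mulr1 oner_eq0.
  have [ltB|leB] := ltnP (#|C| + #|S|) #|B|.
    exists 0%N, (#|C| + #|S|)%N; split => //.
    have X1 : size (1 + 'X : {poly 'F_q}) = 2 by rewrite addrC -polyC1 size_XaddC.
    have X2 : size (1 - 'X : {poly 'F_q}) = 2.
      by rewrite -opprB size_polyN -polyC1 size_XsubC.
    have X1' : (1 + 'X : {poly 'F_q}) ^+ #|C| != 0 by rewrite expf_neq0 // -size_poly_gt0 X1.
    have X2' : (1 - 'X : {poly 'F_q}) ^+ #|S| != 0 by rewrite expf_neq0 // -size_poly_gt0 X2.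
    have sP : (size P).-1 = (#|C| + #|S|)%N.
      rewrite /P size_mul //.
      have := size_exp (1 + 'X : {poly 'F_q}) #|C|.
      have := size_exp (1 - 'X : {poly 'F_q}) #|S|.
      rewrite X1 X2; move: X1' X2'; rewrite -!size_poly_gt0.
      move: (size _) (size _) => u v; lia.
    by rewrite -sP -lead_coefE lead_coef_eq0 mulf_neq0.
  pose j := (#|C| + #|S| + 1 - #|A|)%N.
  have hk n : (0 < n <= #|C|)%N -> n%:R != 0 :> 'F_q.
    by move=> /andP [n0 ln]; apply: natF; rewrite n0 (leq_ltn_trans ln).
  have hm n : (0 < n <= #|S|)%N -> n%:R != 0 :> 'F_q.
    by move=> /andP [n0 ln]; apply: natF; rewrite n0 (leq_ltn_trans ln).
  have ltj : (j < #|C| + #|S|)%N by rewrite /j; lia.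
  case/orP: (no_consecutive_zeros (natF 2 q2) hk hm ltj) => Pj.
    by exists (#|C| + #|S| - j)%N, j; rewrite /j; split => //; lia.
  by exists (#|C| + #|S| - j.+1)%N, j.+1; rewrite /j; split => //; lia.
(* Exactly a + 1 and b + 1 points are kept, as the functionals for the degrees a and b require. *)
pose s1 := take a.+1 (enum A); pose s2 := take b.+1 (enum B).
have z1 : size s1 = a.+1 by rewrite size_takel // -cardE.
have z2 : size s2 = b.+1 by rewrite size_takel // -cardE.
have moments (s : seq 'F_q) n : uniq s -> size s = n.+1 -> exists w : 'F_q -> 'F_q,
    forall i, (i <= n)%N -> \sum_(x <- s) w x * x ^+ i = (i == n)%:R.
  move=> us sz; have [|w hw] := coef_functional us; first by rewrite sz.
  exists w => i lei; have := hw 'X^i; rewrite size_polyXn sz ltnS => /(_ lei).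
  rewrite coefXn eq_sym => <-; apply: eq_bigr => x _.
  by rewrite hornerXn.
have [w1 hw1] := moments s1 a (take_uniq _ (enum_uniq _)) z1.
have [w2 hw2] := moments s2 b (take_uniq _ (enum_uniq _)) z2.
(* The linear factors x + y - c and x - y - s. Each pair of A x B annihilates one of them, so the
   double sum is 0, whereas it equals the nonzero coefficient of index b of [P]. *)
pose ls := [seq (1 : 'F_q, 1 : 'F_q, - c) | c <- enum C] ++
           [seq (1 : 'F_q, -1 : 'F_q, - c) | c <- enum S].
have szls : size ls = (a + b)%N by rewrite size_cat !size_map -!cardE defab.
have := functional_prod_linear hw1 hw2 (ls := ls) (i := 0) (j := 0).
rewrite !addn0 szls leqnn eqxx => /(_ isT).
rewrite big1_seq; last first.
  move=> x /andP [_ /mem_take]; rewrite mem_enum => xA.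
  rewrite big1_seq // => y /andP [_ /mem_take]; rewrite mem_enum => yB.
  suff -> : \prod_(l <- ls) (l.1.1 * x + l.1.2 * y + l.2) = 0 by rewrite !mulr0.
  apply/eqP; rewrite prodf_seq_eq0; apply/hasP.
  have [xyS|xyS] := boolP (x - y \in S).
    exists (1, -1, - (x - y)) => /=; last by rewrite mul1r mulN1r subrr eqxx.
    by rewrite mem_cat orbC; apply/orP; left; apply/mapP; exists (x - y); rewrite ?mem_enum.
  exists (1, 1, - (x + y)) => /=; last by rewrite !mul1r subrr eqxx.
  rewrite mem_cat; apply/orP; left; apply/mapP; exists (x + y) => //.
  by rewrite mem_enum; apply/restr_sumsetP; exists x, y.
move/esym/eqP; apply/negP.
rewrite expr0 mul1r big_cat !big_map /= !big_const_seq !count_predT -!cardE.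
by rewrite !iter_mulr_1 polyCN !polyC1 mul1r mulN1r.
Qed.

(** * Prime quotients and sums over fibres *)

(** A maximal normal subgroup of an abelian group has prime index q, and the quotient is cyclic,
    hence isomorphic to the additive group of F_q. *)
Lemma Fp_quotient_map (G : finZmodType) (H : {group G}) : H :!=: 1%g ->
  exists (q : nat) (K : {group G}) (phi : G -> 'F_q),
    [/\ prime q, (q %| #|H|)%N, K \proper H,
        {in H &, {morph phi : x y / x + y}} &
        {in H, forall x, phi x = 0 -> x \in K}].
Proof.
move=> H1; have abH : abelian H by apply: FinRing.zmod_abelian.
have [N maxN] := ex_maxnormal_ntrivg H1.
have pr := index_maxnormal_sol_prime (abelian_sol abH) maxN.
have nNH := normal_norm (maxnormal_normal maxN).
have cardQ := card_quotient nNH.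
pose q := #|H : N|%g.
have isoQ : isog (H / N)%g [set: 'F_q].
  have cT : #|[set: 'F_q]| = q by rewrite cardsT card_Fp.
  by rewrite isog_cyclic_card ?prime_cyclic ?cT ?cardQ /=.
have [f injf imf] := isogP isoQ.
exists q, N, (fun x => f (coset N x)); split => //.
- exact: dvdn_indexg.
- exact: maxnormal_proper maxN.
- move=> x y xH yH /=; rewrite -FinRing.zmodMgE morphM ?(subsetP nNH) //.
  by rewrite morphM ?mem_quotient.
- move=> x xH fx0; apply: coset_idr; first exact: (subsetP nNH).
  by apply: (injmP injf); rewrite ?mem_quotient ?group1 // morph1 fx0.
Qed.

Definition nsupp (T : finType) (f : T -> nat) : {set T} := [set x | 0 < f x]%N.

Lemma sum_nsupp (T : finType) (f : T -> nat) :
  (\sum_(x in nsupp f) f x = \sum_x f x)%N.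
Proof.
rewrite big_mkcond; apply: eq_bigr => x _.
by rewrite inE; case: (f x).
Qed.

Lemma card_sumE (T : finType) (A : {set T}) : #|A| = (\sum_x (x \in A))%N.
Proof. by rewrite -sum1_card big_mkcond; apply: eq_bigr => x _; case: (_ \in _). Qed.

Lemma leq_sum_inj (T U : finType) (h : T -> nat) (t : U -> T) (A : {set U}) :
  injective t -> (\sum_(x in A) h (t x) <= \sum_y h y)%N.
Proof.
move=> injt; rewrite -(big_imset h (in2W injt)) big_mkcond.
by apply: leq_sum => y _; case: ifP.
Qed.

Lemma leq_sum_translate (G : finZmodType) (h : G -> nat) (i : G) (A : {set G}) :
  (\sum_(j in A) h (i + j)%R <= \sum_k h k)%N.
Proof. exact: leq_sum_inj (@addrI _ i). Qed.

Lemma leq_sum_reflect (G : finZmodType) (h : G -> nat) (i : G) (A : {set G}) :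
  (\sum_(j in A) h (i - j)%R <= \sum_k h k)%N.
Proof. exact: leq_sum_inj (@subrI _ i). Qed.

(** At least |supp c| - |J| points of the support of [c] lie outside i + J, and each adds at least 1
    to the full sum. *)
Lemma sum_translate_le (G : finZmodType) (c : G -> nat) (i : G) (J : {set G}) :
  (\sum_(j in J) c (i + j)%R + #|nsupp c| <= \sum_k c k + #|J|)%N.
Proof.
have -> : (\sum_(j in J) c (i + j)%R = \sum_k (k - i \in J)%R * c k)%N.
  rewrite [RHS](reindex_inj (addrI i)) big_mkcond /=; apply: eq_bigr => j _.
  by rewrite addrAC subrr add0r; case: (_ \in _); rewrite ?mul1n.
have -> : #|J| = (\sum_k (k - i \in J)%R)%N.
  rewrite (reindex_inj (addrI i)) card_sumE; apply: eq_bigr => j _.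
  by rewrite addrAC subrr add0r.
rewrite card_sumE -!big_split; apply: leq_sum => k _ /=.
rewrite inE; case: (_ \in _); case: (c k) => //= n; lia.
Qed.

(* lia does not identify numbers hidden behind distinct instances of [#|_|] and
   [\sum]; naming them by local definitions and clearing the bodies helps. *)
Ltac olia := repeat match goal with x := _ |- _ => clearbody x end; lia.

(** * The inequality for fibre sizes over a group of prime order *)

Section WeightedSumset.
Variables (T : finZmodType) (f g s c : T -> nat).
Let q := #|[set: T]|.
Hypothesis q_prime : prime q.
Hypothesis restr_sumset_bound : forall A B S : {set T},
  A != set0 -> B != set0 -> (0 < #|S| < q)%N -> (#|restr_sumset A B S| < q)%N ->
  (#|A| + #|B| <= #|restr_sumset A B S| + #|S| + 2)%N.
Let I : {set T} := nsupp f.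
Let J : {set T} := nsupp g.
Let Sf := (\sum_i f i)%N.
Let Sg := (\sum_i g i)%N.
Let Ss := (\sum_i s i)%N.
Let Sc := (\sum_i c i)%N.
Let nI := #|I|.
Let nJ := #|J|.
Let nC := #|nsupp c|.
Hypotheses (I0 : I != set0) (J0 : J != set0) (s_gt0 : (0 < Ss)%N).
Hypothesis leIJ : (nI <= nJ)%N.
Hypothesis free_pair : forall i j : T, i \in I -> j \in J ->
  s (i - j)%R = 0%N -> (f i + g j <= c (i + j)%R + 1)%N.
Hypothesis pair : forall i j : T, i \in I -> j \in J ->
  (0 < s (i - j)%R)%N -> (f i + g j <= c (i + j)%R + 3 * s (i - j)%R)%N.
Hypothesis pairl : forall i j : T, i \in I -> j \in J -> (f i <= c (i + j)%R + s (i - j)%R)%N.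
Hypothesis pairr : forall i j : T, i \in I -> j \in J -> (g j <= c (i + j)%R + s (i - j)%R)%N.
Hypothesis supp_c : (nC < q)%N.

Lemma row_shiftE (i : T) (h : T -> nat) (A : {set T}) :
  (\sum_(j in A) h (i - j)%R = \sum_k (i - k \in A)%R * h k)%N.
Proof.
rewrite (reindex_inj (subrI i)) big_mkcond /=; apply: eq_bigr => k _.
by rewrite subKr; case: (_ \in _); rewrite ?mul1n.
Qed.

Lemma free_sumset_le (A B : {set T}) : A != set0 -> B != set0 ->
  (forall a b, a \in A -> b \in B -> (0 < c (a + b)%R)%N) ->
  (#|A| + #|B| <= nC + 1)%N.
Proof.
move=> A0 B0 hc.
have sub : sumset A B \subset nsupp c.
  by apply/subsetP => _ /imset2P [a b aA bB ->]; rewrite inE hc.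
have le := subset_leq_card sub.
apply: (leq_trans (Cauchy_Davenport A0 B0 _)); last by rewrite leq_add2r.
by rewrite [X in (_ < X)%N](pdiv_id q_prime) (leq_ltn_trans le).
Qed.

Lemma restr_sumset_le (A B M : {set T}) : A != set0 -> B != set0 ->
  (0 < #|M| < q)%N ->
  (forall a b, a \in A -> b \in B -> a - b \notin M -> (0 < c (a + b)%R)%N) ->
  (#|A| + #|B| <= nC + #|M| + 2)%N.
Proof.
move=> A0 B0 hM hc.
have sub : restr_sumset A B M \subset nsupp c.
  by apply/subsetP => _ /restr_sumsetP [a [b [aA bB abM ->]]]; rewrite inE hc.
have le := subset_leq_card sub.
apply: (leq_trans (restr_sumset_bound A0 B0 hM _)); last by rewrite !leq_add2r.
exact: leq_ltn_trans le supp_c.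
Qed.

(** One row of pairs (i, j) already gives Sg <= Sc + Ss, and Sf fits into the remaining 2 Ss. *)
Lemma weighted_sumset_light : (Sf <= 2 * Ss)%N ->
  (Sf + Sg <= Sc + 3 * Ss)%N.
Proof.
move=> le; have /set0Pn [i iI] := I0.
pose u := (\sum_(j in J) c (i + j)%R)%N; pose v := (\sum_(j in J) s (i - j)%R)%N.
have hg : (Sg <= u + v)%N.
  rewrite -[Sg](sum_nsupp g) -big_split; apply: leq_sum => j jJ; exact: pairr.
have hu : (u <= Sc)%N by apply: leq_sum_translate.
have hv : (v <= Ss)%N by apply: leq_sum_reflect.
olia.
Qed.

(** The exceptional case in which the general count falls short by one. If g (i - d) <= s d for some
    i, row i without column i - d is summed. Otherwise every class a + b is nonempty, and
    Cauchy-Davenport replaces the restricted bound, gaining 2. *)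
Lemma weighted_sumset_unit (d : T) :
  (forall i, f i <= 1)%N -> (forall k, k != d -> s k = 0%N) ->
  (Sf + Sg <= Sc + 3 * Ss)%N.
Proof.
move=> f1 sd.
have sumf : Sf = nI.
  rewrite /Sf /nI card_sumE; apply: eq_bigr => i _; rewrite inE.
  by case: (f i) (f1 i) => [|[|]].
have sums : Ss = s d.
  by rewrite /Ss (bigD1 d) //= big1 ?addn0.
have offd a b : a - b != d -> s (a - b)%R = 0%N by apply: sd.
have [i /andP [iI gi]|big] := pickP [pred i | (i \in I) && (g (i - d)%R <= s d)%N].
  pose J' : {set T} := J :\ (i - d); pose nJ' := #|J'|; pose u := (\sum_(j in J') c (i + j)%R)%N.
  have hu : (u + nC <= Sc + nJ')%N by apply: sum_translate_le.
  have hg : (Sg <= g (i - d)%R + u)%N.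
    rewrite /Sg (bigD1 (i - d)) //= leq_add2l /u big_mkcond [leqRHS]big_mkcond.
    apply: leq_sum => j _; rewrite !inE; case: eqP => //= /eqP nj.
    case: (posnP (g j)) => [-> //|gj].
    have jJ : j \in J by rewrite inE.
    have nd : i - j != d by apply: contraNneq nj => <-; rewrite subKr.
    have := free_pair iI jJ (offd _ _ nd); move: (iI); rewrite inE; olia.
  have N : (nI + nJ <= nC + 1 + 2)%N.
    have := @restr_sumset_le I J [set d]; rewrite cards1 prime_gt1 //.
    apply=> // a b aI bJ; rewrite inE => /offd sab; have := pairl aI bJ.
    by rewrite sab addn0; apply: leq_trans; rewrite inE in aI.
  have cJ : nJ = (((i - d)%R \in J) + nJ')%N by rewrite /nJ /nJ' (cardsD1 (i - d)).
  have gd : (g (i - d)%R <= ((i - d)%R \in J) * s d)%N.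
    by rewrite inE; case: posnP => [->|]; rewrite ?mul1n.
  move: cJ gd; case: (_ \in J) => /=; olia.
have N : (nI + nJ <= nC + 1)%N.
  apply: free_sumset_le => // a b aI bJ.
  have [ab|/offd sab] := eqVneq (a - b) d.
    have := big a; rewrite /= aI -ab subKr /= => /negbT; rewrite -ltnNge.
    by have := pairr aI bJ; olia.
  have := pairl aI bJ; rewrite sab; rewrite inE in aI; olia.
have /set0Pn [i iI] := I0.
pose u := (\sum_(j in J) c (i + j)%R)%N; pose v := (\sum_(j in J) s (i - j)%R)%N.
have hg : (Sg <= u + v)%N.
  rewrite -[Sg](sum_nsupp g) -big_split; apply: leq_sum => j jJ; exact: pairr.
have hu : (u + nC <= Sc + nJ)%N by apply: sum_translate_le.
have hv : (v <= Ss)%N by apply: leq_sum_reflect.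
move: s_gt0; olia.
Qed.

Lemma weighted_sumset :
  (Sf + Sg <= Sc + 3 * Ss)%N.
Proof.
case: (leqP Sf (2 * Ss)) => [|heavy]; first exact: weighted_sumset_light.
have /set0Pn [x0 x0I] := I0.
have [i iI maxi] : exists2 i, i \in I & forall k, (f k <= f i)%N.
  case: (arg_maxnP f (isT : predT x0)) => i _ maxi; exists i => [|k].
    by rewrite inE; apply: leq_trans (maxi x0 isT); rewrite inE in x0I.
  exact: maxi.
set F := f i in maxi; have F0 : (0 < F)%N by rewrite inE in iI.
(* Row [i] of the pairs contributes [u] to [Sc]; the classes outside it are
   counted by [nC - nJ], where [nC] is bounded below by means of the pairs
   (a, b) with [f a = F] and [a - b \notin M], whose classes are nonempty. *)
pose I' := [set k | f k == F]; pose M := [set k | F <= s k]%N.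
have I'0 : I' != set0 by apply/set0Pn; exists i; rewrite inE.
pose h := (\sum_(j in J) (F <= s (i - j)%R))%N.
pose z := (\sum_(j in J) (s (i - j)%R == 0))%N.
pose u := (\sum_(j in J) c (i + j)%R)%N.
pose sig := (\sum_(j in J) s (i - j)%R)%N.
(* Where s = 0 the free bound loses 1, counted by [z]. Where F <= s, adding 2F <= 2s to g j <= c + s
   leaves a surplus F, counted by [h]. *)
have row : (nJ * F + Sg + h * F <= u + 3 * sig + z)%N.
  rewrite -[Sg](sum_nsupp g) /nJ -sum_nat_const /h /z /sig /u big_distrl big_distrr /=.
  rewrite -!big_split /=; apply: leq_sum => j jJ.
  have := free_pair iI jJ; have := pair iI jJ; have := pairr iI jJ.
  rewrite -/F; case: (posnP (s (i - j))) => [->|s0].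
    have -> : (F <= 0)%N = false by rewrite leqNgt F0.
    by move=> _ _ /(_ erefl) /=; olia.
  move=> h1 /(_ isT) h2 _; case: (leqP F (s (i - j)%R)) => /= hF; olia.
have zh : (z + h <= nJ)%N.
  rewrite /nJ -sum1_card /z /h -big_split; apply: leq_sum => j _ /=.
  case: (posnP (s (i - j)%R)) => [->|s1]; last by case: (F <= _)%N.
  have -> : (F <= 0)%N = false by rewrite leqNgt F0.
  by [].
(* The elements of [M] not met in row i contribute at least F each to [Ss], beyond [sig]. *)
have leM : (sig + #|M| * F <= Ss + h * F)%N.
  rewrite /sig /h /Ss row_shiftE card_sumE.
  rewrite (row_shiftE i (fun x => nat_of_bool (F <= s x)%N)) !big_distrl -!big_split /=.
  apply: leq_sum => k _; rewrite [k \in M]inE.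
  by case: ((i - k)%R \in J); case: (leqP F (s k)) => /=; olia.
have sumf : (Sf + nI <= nI * F + #|I'|)%N.
  rewrite /Sf /nI !card_sumE big_distrl -!big_split /=; apply: leq_sum => k _.
  by rewrite !inE; have := maxi k; case: (f k) => [|n]; case: eqP => /=; olia.
have transl : (u + nC <= Sc + nJ)%N by apply: sum_translate_le.
have sumfF : (Sf <= q * F)%N.
  rewrite /Sf /q card_sumE big_distrl /=.
  by apply: leq_sum => k _; rewrite inE mul1n.
have MF : (#|M| * F <= Ss)%N.
  rewrite /Ss card_sumE big_distrl /=; apply: leq_sum => k _.
  by rewrite inE; case: leqP => //=; olia.
have hM : (h <= #|M|)%N.
  rewrite /h card_sumE (row_shiftE i (fun x => nat_of_bool (F <= s x)%N)).
  by apply: leq_sum => k _; rewrite [k \in M]inE; case: ((i - k)%R \in J); rewrite ?mul1n.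
(* This is (nJ - nI) (F - 1) >= 0, the point where [leIJ] enters. *)
have IJF : (nI * F + nJ <= nJ * F + nI)%N.
  have := leq_mul leIJ (leqnn F.-1); rewrite -(prednK F0) !mulnS; olia.
have [M0|M0] := posnP #|M|.
  have Mempty k : (s k < F)%N.
    by have := cards0_eq M0 => /setP /(_ k); rewrite !inE ltnNge => ->.
  have N : (#|I'| + nJ <= nC + 1)%N.
    apply: free_sumset_le => // a b; rewrite inE => /eqP fa bJ.
    have aI : a \in I by rewrite inE fa.
    have := pairl aI bJ; have := Mempty (a - b); olia.
  have zsig : (sig + Ss * z <= Ss * nJ)%N.
    rewrite /sig /z /nJ -sum1_card !big_distrr -big_split; apply: leq_sum => j _ /=.
    have : (s (i - j)%R <= Ss)%N by rewrite /Ss (bigD1 (i - j)) //= leq_addr.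
    by case: eqP => [->|_]; rewrite muln1 ?muln0 ?addn0.
  have h0 : h = 0%N by apply/eqP; rewrite -leqn0 -M0.
  rewrite h0 mul0n !addn0 in row zh; rewrite M0 h0 !mul0n !addn0 in leM.
  have [zJ|zJ] := leqP nJ z; last by olia.
  have := leq_mul (leqnn Ss) zJ; olia.
(* Otherwise q F <= |M| F <= Ss, while 2 Ss < Sf <= q F. *)
have Mq : (#|M| < q)%N.
  rewrite ltnNge; apply/negP => leqM; have := leq_mul leqM (leqnn F); olia.
have N : (#|I'| + nJ <= nC + #|M| + 2)%N.
  apply: restr_sumset_le => //; first by rewrite M0.
  move=> a b; rewrite inE => /eqP fa bJ; rewrite inE -ltnNge => small.
  have aI : a \in I by rewrite inE fa.
  have := pairl aI bJ; olia.
have [/andP [/eqP F1 /eqP M1]|nonunit] := boolP ((F == 1) && (#|M| == 1))%N.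
  have /cards1P [d Md] : #|M| == 1%N by rewrite M1.
  apply: (@weighted_sumset_unit d) => k; first by rewrite -F1.
  move=> kd; have : k \notin M by rewrite Md inE.
  by rewrite inE F1 -ltnNge ltnS leqn0 => /eqP.
(* This is what remains after combining [row], [zh], [leM], [sumf], [transl], [IJF] and [N]. For h =
   |M| it reads 2 <= |M| F, which fails only in the unit case. *)
have key : (2 + (#|M| - h) <= 3 * ((#|M| - h) * F) + h * F)%N.
  have hF : (#|M| - h <= (#|M| - h) * F)%N by rewrite leq_pmulr.
  have [e|] := posnP (#|M| - h); last by olia.
  have eh : h = #|M| by olia.
  rewrite e eh !mul0n muln0 add0n; move: nonunit; rewrite negb_and.
  case/orP => [F1|M1].
    have F2 : (2 <= F)%N by rewrite ltn_neqAle eq_sym F1.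
    exact: leq_mul M0 F2.
  have M2 : (2 <= #|M|)%N by rewrite ltn_neqAle eq_sym M1.
  by have := leq_mul M2 F0.
rewrite mulnBl in key; have := leq_mul hM (leqnn F); olia.
Qed.
End WeightedSumset.

(** Exchanging [f] and [g] turns s k into s (- k), so the support of [f] may be assumed not larger
    than that of [g]. *)
Lemma weighted_sumset_bound (T : finZmodType) (f g s c : T -> nat) :
  prime #|[set: T]| ->
  (forall A B S : {set T}, A != set0 -> B != set0 ->
     (0 < #|S| < #|[set: T]|)%N -> (#|restr_sumset A B S| < #|[set: T]|)%N ->
     (#|A| + #|B| <= #|restr_sumset A B S| + #|S| + 2)%N) ->
  nsupp f != set0 -> nsupp g != set0 -> (0 < \sum_k s k)%N ->
  (forall i j : T, i \in nsupp f -> j \in nsupp g ->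
     s (i - j)%R = 0%N -> (f i + g j <= c (i + j)%R + 1)%N) ->
  (forall i j : T, i \in nsupp f -> j \in nsupp g ->
     (0 < s (i - j)%R)%N -> (f i + g j <= c (i + j)%R + 3 * s (i - j)%R)%N) ->
  (forall i j : T, i \in nsupp f -> j \in nsupp g ->
     (f i <= c (i + j)%R + s (i - j)%R)%N) ->
  (forall i j : T, i \in nsupp f -> j \in nsupp g ->
     (g j <= c (i + j)%R + s (i - j)%R)%N) ->
  (#|nsupp c| < #|[set: T]|)%N ->
  (\sum_i f i + \sum_j g j <= \sum_k c k + 3 * \sum_k s k)%N.
Proof.
move=> pT bound f0 g0 s0 h0 h3 hl hr hc.
have [le|/ltnW le] := leqP #|nsupp f| #|nsupp g|.
  exact: (weighted_sumset pT bound).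
have sums : (\sum_k s (- k)%R = \sum_k s k)%N by rewrite [RHS](reindex_inj oppr_inj).
rewrite addnC -sums; apply: (weighted_sumset pT bound) => //; first by rewrite sums.
all: move=> j i jJ iI; rewrite opprB [(j + i)%R]addrC //.
- by rewrite addnC; apply: h0.
- by rewrite addnC; apply: h3.
- exact: hr.
- exact: hl.
Qed.

(** * Induction on subgroups and conclusion *)

(** For a fixed b, a sum a + b missing from the restricted sumset has a - b in S, so it lies in S +
    2b. *)
Lemma leq_card_restr_sumsetl (G : finZmodType) (A B S : {set G}) :
  B != set0 -> (#|A| <= #|restr_sumset A B S| + #|S|)%N.
Proof.
case/set0Pn => b bB.
rewrite -(card_imset (mem A) (addIr b)) -(card_imset (mem S) (addIr (b + b))).
apply: leq_trans (leq_card_setU _ _); apply: subset_leq_card.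
apply/subsetP => _ /imsetP [a aA ->]; rewrite inE.
have [abS|abS] := boolP (a - b \in S).
  by apply/orP; right; apply/imsetP; exists (a - b) => //; rewrite addrA subrK.
by apply/orP; left; apply/restr_sumsetP; exists a, b.
Qed.

Lemma leq_card_restr_sumsetr (G : finZmodType) (A B S : {set G}) :
  A != set0 -> (#|B| <= #|restr_sumset A B S| + #|S|)%N.
Proof.
case/set0Pn => a aA.
rewrite -(card_imset (mem B) (addrI a)) -(card_imset (mem S) (@subrI _ (a + a))).
apply: leq_trans (leq_card_setU _ _); apply: subset_leq_card.
apply/subsetP => _ /imsetP [b bB ->]; rewrite inE.
have [abS|abS] := boolP (a - b \in S).
  by apply/orP; right; apply/imsetP; exists (a - b) => //; rewrite opprB addrACA subrr addr0.
by apply/orP; left; apply/restr_sumsetP; exists a, b.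
Qed.

Lemma sum_card_fibre (T U : finType) (h : T -> U) (A : {set T}) :
  (\sum_u #|[set x in A | h x == u]| = #|A|)%N.
Proof.
rewrite -[RHS]sum1_card (partition_big h xpredT) //=; apply: eq_bigr => u _.
by rewrite -sum1_card; apply: eq_bigl => x; rewrite inE.
Qed.

(** Only differences are required to lie in H, since the fibres lie in cosets of K. The prime bound
    stays that of G, so the fibres inherit it. For trivial H the claim is 2 <= 3|S|. *)
Lemma restr_sumset_coset (G : finZmodType) (H : {group G}) (A B S : {set G}) :
  (2 < pdiv #|[set: G]|)%N -> A != set0 -> B != set0 -> S != set0 ->
  {in A &, forall x y, x - y \in H} -> {in B &, forall x y, x - y \in H} ->
  (#|restr_sumset A B S| < pdiv #|[set: G]|)%N ->
  (#|A| + #|B| <= #|restr_sumset A B S| + 3 * #|S|)%N.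
Proof.
move=> p2; have [n] := ubnP #|H|; elim: n H A B S => // n IHn H A B S /ltnSE leHn.
move=> A0 B0 S0 AH BH ltC.
have [H1|H1] := eqVneq (H :> {set G}) 1%g.
  have le1 (X : {set G}) : {in X &, forall x y, x - y \in H} -> (#|X| <= 1)%N.
    move=> XH; rewrite leqNgt; apply/negP => /card_gt1P [x [y [xX yX]]].
    have := XH x y xX yX; rewrite H1 => /set1P /eqP; rewrite subr_eq0 => -> //.
  have := le1 A AH; have := le1 B BH; rewrite -card_gt0 in S0.
  move: S0; move: #|A| #|B| #|S|; lia.
have [T [K [phi [[pT leT bound] KH phiD phi0]]]] :
    exists (T : finZmodType) (K : {group G}) (phi : G -> T),
    [/\ [/\ prime #|[set: T]|, (pdiv #|[set: G]| <= #|[set: T]|)%N &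
         forall A B S : {set T}, A != set0 -> B != set0 ->
           (0 < #|S| < #|[set: T]|)%N -> (#|restr_sumset A B S| < #|[set: T]|)%N ->
           (#|A| + #|B| <= #|restr_sumset A B S| + #|S| + 2)%N],
        K \proper H,
        {in H &, {morph phi : x y / x + y}} &
        {in H, forall x, phi x = 0 -> x \in K}].
  have [q [K [phi [pq qH KH phiD phi0]]]] := Fp_quotient_map H1.
  have leq_p : (pdiv #|[set: G]| <= q)%N.
    apply: pdiv_min_dvd; first exact: prime_gt1.
    by apply: (dvdn_trans qH); apply: cardSg; apply: subsetT.
  have cT : #|[set: 'F_q]| = q by rewrite cardsT card_Fp.
  exists 'F_q, K, phi; split => //; rewrite cT; split => //.
  by move=> A' B' S'; apply: restr_sumset_Fp => //; apply: leq_trans leq_p.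
have /set0Pn [a0 a0A] := A0; have /set0Pn [b0 b0B] := B0.
have HB x y : x \in H -> y \in H -> x - y \in H.
  by move=> xH yH; apply: (groupM xH (groupVr yH)).
have phiB x y : x \in H -> y \in H -> phi (x - y) = phi x - phi y.
  by move=> xH yH; apply/eqP; rewrite eq_sym subr_eq -phiD ?HB // subrK.
set C := restr_sumset A B S in ltC *.
(* [phi] is additive only on [H], hence the base points. Elements of S outside the coset of a0 - b0
   fall into arbitrary fibres, harmlessly: the fibres still partition S, and [subC] holds. *)
pose Af i := [set a in A | phi (a - a0) == i]; pose Bf i := [set b in B | phi (b - b0) == i].
pose Sf i := [set x in S | phi (x - (a0 - b0)) == i].
pose Cf i := [set x in C | phi (x - (a0 + b0)) == i].
have subC i j : restr_sumset (Af i) (Bf j) (Sf (i - j)%R) \subset Cf (i + j).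
  apply/subsetP => _ /restr_sumsetP [a [b [+ + abS ->]]].
  rewrite !inE => /andP [aA /eqP ia] /andP [bB /eqP jb].
  have [aH bH] := (AH a a0 aA a0A, BH b b0 bB b0B).
  have phiab : phi (a - b - (a0 - b0)) = i - j.
    by rewrite -ia -jb -phiB // [- (a0 - b0)]opprD addrACA -opprD.
  have phiab' : phi (a + b - (a0 + b0)) = i + j.
    by rewrite -ia -jb -phiD // opprD addrACA.
  rewrite phiab' eqxx andbT; apply/restr_sumsetP; exists a, b; split => //.
  by apply: contraNN abS => abS; rewrite inE abS phiab eqxx.
have leC i j : (#|restr_sumset (Af i) (Bf j) (Sf (i - j)%R)| <= #|Cf (i + j)%R|)%N.
  exact: subset_leq_card.
have ltp i j : (#|restr_sumset (Af i) (Bf j) (Sf (i - j)%R)| < pdiv #|[set: G]|)%N.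
  apply: leq_ltn_trans ltC; apply: (leq_trans (leC i j)); apply: subset_leq_card.
  by apply/subsetP => x; rewrite inE => /andP [].
have memf (X : T -> {set G}) i : (i \in nsupp (fun i => #|X i|)) = (X i != set0).
  by rewrite inE card_gt0.
rewrite -(sum_card_fibre (fun a => phi (a - a0)) A) -(sum_card_fibre (fun b => phi (b - b0)) B).
rewrite -(sum_card_fibre (fun x => phi (x - (a0 - b0))) S).
rewrite -(sum_card_fibre (fun x => phi (x - (a0 + b0))) C).
apply: (@weighted_sumset_bound T (fun i => #|Af i|) (fun i => #|Bf i|)
  (fun i => #|Sf i|) (fun i => #|Cf i|)) => //.
- apply/set0Pn; exists (phi (a0 - a0)); rewrite memf.
  by apply/set0Pn; exists a0; rewrite inE a0A eqxx.
- apply/set0Pn; exists (phi (b0 - b0)); rewrite memf.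
  by apply/set0Pn; exists b0; rewrite inE b0B eqxx.
- by rewrite sum_card_fibre card_gt0.
- move=> i j; rewrite !memf => Ai Bj /cards0_eq Sij.
  have sub : sumset (Af i) (Bf j) \subset restr_sumset (Af i) (Bf j) (Sf (i - j)%R).
    apply/subsetP => _ /imset2P [a b aA bB ->]; apply/restr_sumsetP; exists a, b.
    by split => //; rewrite [Sf _]Sij inE.
  have le := subset_leq_card sub.
  have := Cauchy_Davenport Ai Bj (leq_ltn_trans le (ltp i j)).
  move/leq_trans; apply; rewrite leq_add2r; exact: leq_trans (leC i j).
- move=> i j; rewrite !memf => Ai Bj; rewrite card_gt0 => Sij.
  have inK (X : {set G}) x0 k : x0 \in X -> {in X &, forall x y, x - y \in H} ->
      {in [set x in X | phi (x - x0) == k] &, forall x y, x - y \in K}.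
    move=> x0X XH x y; rewrite !inE => /andP [xX /eqP xk] /andP [yX /eqP yk].
    apply: phi0; first exact: XH.
    have -> : x - y = (x - x0) - (y - x0) by rewrite opprB addrA subrK.
    by rewrite phiB ?XH // xk yk subrr.
  have := IHn K (Af i) (Bf j) (Sf (i - j)%R) (leq_trans (proper_card KH) leHn) Ai Bj Sij
    (inK A a0 i a0A AH) (inK B b0 j b0B BH) (ltp i j).
  by move/leq_trans; apply; rewrite leq_add2r.
- move=> i j; rewrite !memf => Ai Bj.
  apply: leq_trans (leq_card_restr_sumsetl _ (Sf (i - j)%R) Bj) _.
  by rewrite leq_add2r.
- move=> i j; rewrite !memf => Ai Bj.
  apply: leq_trans (leq_card_restr_sumsetr _ (Sf (i - j)%R) Ai) _.
  by rewrite leq_add2r.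
(* The nonempty fibres of C number at most |C|, which is less than p(G) and so than |T|. *)
apply: leq_trans leT; apply: leq_ltn_trans ltC.
rewrite -(sum_card_fibre (fun x => phi (x - (a0 + b0))) C) -sum1_card big_mkcond.
by apply: leq_sum => k _; rewrite inE; case: ifP.
Qed.

Theorem theorem1p1 (G : finZmodType) (A B S : {set G}) :
  (1 < #|[set: G]|)%N ->
  A != set0 -> B != set0 -> S != set0 ->
  (Order.min (#|A|%:Z + #|B|%:Z - 3 * #|S|%:Z) (pG G)%:Z
     <= #|restr_sumset A B S|%:Z)%R.
Proof.
move=> G1 A0 B0 S0; rewrite ge_min.
have [gep|ltp] := leqP (pG G) #|restr_sumset A B S|.
  by apply/orP; right; rewrite lez_nat.
apply/orP; left.
suff : (#|A| + #|B| <= #|restr_sumset A B S| + 3 * #|S|)%N.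
  move: #|A| #|B| #|S| #|restr_sumset A B S|; lia.
have : (1 < pG G)%N by rewrite prime_gt1 // pdiv_prime.
rewrite leq_eqVlt => /orP [/eqP p2|p2].
  (* For p(G) = 2, |C| <= 1 <= |S|, so adding the two one-sided bounds gives 2|C| + 2|S| <= |C| +
     3|S|. *)
  have := leq_card_restr_sumsetl A S B0; have := leq_card_restr_sumsetr B S A0.
  move: ltp S0; rewrite -p2 -card_gt0.
  move: #|A| #|B| #|S| #|restr_sumset A B S|; lia.
apply: (@restr_sumset_coset G [set: G]%G) => // x y _ _; exact: in_setT.
Qed.
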